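(* Let $\kappa:\mathbb N\to(0,\infty)$ be any function with $\lim_{n\to\infty}\kappa(n)=0$ and $\lim_{n\to\infty}\frac{n\,\kappa(n)}{\log n}=\infty$. Then there exists a family of distributions $\mathcal D_n$ over permutations of $[n]$ such that $\mathrm{val}_{\mathcal D_n}=\Omega(1)$, but every algorithm $\mathrm{ALG}$ whose stopping rule can be computed by circuits of size $2^{n\kappa(n)/4}$ satisfies $\mathrm{val}_{\mathcal D_n}(\mathrm{ALG},\ast)=O(\kappa(n))$.
   Context: Items are $[n]$. Nature draws an arrival order $\pi\sim\mathcal D_n$ ($\pi(i)$ is the arrival time of item $i$). The adversary's ordering of items by value is a permutation $\sigma$ of $[n]$ ($\sigma(j)$ is the item with the $j$-th largest value), possibly drawn from a distribution $\underline\sigma$ independent of $\pi$. An online algorithm sees items in arrival order and at each time irrevocably decides whether to select the current item (at most one selection); it is comparison-based: the decision at time $t$ depends only on the relative order by value of the first $t$ arrived items. Its stopping rule is the function mapping this relative order (encoded as a bit string, e.g. pairwise comparisons) to the decision at time $t$; it is computable by circuits of size $s$ if for each $t$ there is a Boolean circuit of size at most $s$ computing it. $\mathrm{val}_{\mathcal D}(\mathrm{ALG},\underline\sigma)$ is the probability that ALG selects the maximum-value item; $\mathrm{val}_{\mathcal D}(\mathrm{ALG},\ast)=\min_{\underline\sigma}\mathrm{val}_{\mathcal D}(\mathrm{ALG},\underline\sigma)$ and $\mathrm{val}_{\mathcal D}=\min_{\underline\sigma}\max_{\mathrm{ALG}}\mathrm{val}_{\mathcal D}(\mathrm{ALG},\underline\sigma)$.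 $\Omega(1)$ and $O(\kappa(n))$ are as $n\to\infty$, with constants independent of $n$ and of ALG. *)

(* Defs.v *)
From HB Require Import structures.
From mathcomp Require Import all_boot all_order all_algebra all_fingroup.
From mathcomp Require Import all_classical all_reals all_analysis.

Set Implicit Arguments.
Unset Strict Implicit.
Unset Printing Implicit Defensive.

Import Order.TTheory GRing.Theory Num.Theory.
Import numFieldNormedType.Exports.

Local Open Scope classical_set_scope.
Local Open Scope ring_scope.

(* Boolean circuits over the basis {AND, OR, NOT}, fan-in at most 2, as
   straight-line programs: on N inputs, wires 0, ..., N - 1 are the inputs and
   wire N + i is the output of the i-th gate. *)

Inductive gate : Type :=
  | AndGate of nat & nat
  | OrGate of nat & nat
  | NotGate of nat.

Definition gate_wf (m : nat) (g : gate) : bool :=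
  match g with
  | AndGate i j => (i < m)%N && (j < m)%N
  | OrGate i j => (i < m)%N && (j < m)%N
  | NotGate i => (i < m)%N
  end.

Definition gate_eval (w : seq bool) (g : gate) : bool :=
  match g with
  | AndGate i j => nth false w i && nth false w j
  | OrGate i j => nth false w i || nth false w j
  | NotGate i => ~~ nth false w i
  end.

Record circuit : Type := Circuit { gates : seq gate; output : nat }.

Fixpoint gates_wf (m : nat) (gs : seq gate) : bool :=
  if gs is g :: gs' then gate_wf m g && gates_wf m.+1 gs' else true.

Definition circuit_wf (N : nat) (C : circuit) : bool :=
  gates_wf N (gates C) && (output C < N + size (gates C))%N.

Definition circuit_size (C : circuit) : nat := size (gates C).

Definition circuit_eval (C : circuit) (x : seq bool) : bool :=
  nth false (foldl (fun w g => rcons w (gate_eval w g)) x (gates C)) (output C).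

(* Items, arrival times and value ranks are all elements of 'I_n, counted from
   0. The arrival order pi maps an item to its arrival time; the value order
   sigma maps a rank to the item of that rank, rank 0 being the maximum. *)

Definition rank_at (n : nat) (pi sigma : {perm 'I_n}) (a : 'I_n) : 'I_n :=
  (sigma^-1)%g ((pi^-1)%g a).

Definition times_upto (n : nat) (t : 'I_n) : seq 'I_n :=
  [seq a : 'I_n <- enum 'I_n | (a <= t)%N].

(* The relative order of the items arrived at times 0, ..., t, encoded by all
   (t + 1)^2 pairwise comparisons: the bit of (a, b) tells whether the item
   arriving at time a has larger value than the one arriving at time b. *)
Definition relative_order (n : nat) (pi sigma : {perm 'I_n}) (t : 'I_n) :
    seq bool :=
  [seq (rank_at pi sigma a < rank_at pi sigma b)%N
     | a <- times_upto t, b <- times_upto t].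

(* A comparison-based algorithm, given by its stopping rule. *)
Definition algorithm (n : nat) : Type := 'I_n -> seq bool -> bool.

Definition stops_at (n : nat) (A : algorithm n) (pi sigma : {perm 'I_n})
    (t : 'I_n) : bool :=
  A t (relative_order pi sigma t) &&
  [forall u : 'I_n, (u < t)%N ==> ~~ A u (relative_order pi sigma u)].

Definition selects (n : nat) (A : algorithm n) (pi sigma : {perm 'I_n})
    (i : 'I_n) : bool := stops_at A pi sigma (pi i).

Definition selects_max (n : nat) (A : algorithm n) (pi sigma : {perm 'I_n}) :
    bool :=
  [exists j : 'I_n, (nat_of_ord j == 0%N) && selects A pi sigma (sigma j)].

(* Only bit strings that encode a relative order constrain the circuit. *)
Definition computable_by_size (R : realType) (n : nat) (A : algorithm n)
    (s : R) : Prop :=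
  forall t : 'I_n, exists C : circuit,
    [/\ circuit_wf (t.+1 * t.+1) C,
        (circuit_size C)%:R <= s
      & forall pi sigma : {perm 'I_n},
          circuit_eval C (relative_order pi sigma t) =
          A t (relative_order pi sigma t)].

Record distr (R : realType) (T : finType) : Type := Distr {
  pmf :> T -> R;
  pmf_ge0 : forall x, 0 <= pmf x;
  pmf_sum1 : \sum_(x : T) pmf x = 1 }.

Definition win_prob (R : realType) (n : nat) (D : distr R {perm 'I_n})
    (A : algorithm n) (Q : distr R {perm 'I_n}) : R :=
  \sum_(pi : {perm 'I_n}) \sum_(sigma : {perm 'I_n} | selects_max A pi sigma)
    D pi * Q sigma.

(* The infima over distributions Q (a compact simplex) and the supremum over
   algorithms (finitely many distinct behaviours) are attained, hence minima and
   a maximum; all the sets involved are nonempty subsets of [0, 1]. *)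

Definition val_alg (R : realType) (n : nat) (D : distr R {perm 'I_n})
    (A : algorithm n) : R :=
  inf (range (fun Q : distr R {perm 'I_n} => win_prob D A Q)).

Definition val_opt (R : realType) (n : nat) (D : distr R {perm 'I_n}) : R :=
  inf (range (fun Q : distr R {perm 'I_n} =>
    sup (range (fun A : algorithm n => win_prob D A Q)))).

(* Main.v *)
Require Import Defs.
From HB Require Import structures.
From mathcomp Require Import all_boot all_order all_algebra all_fingroup.
From mathcomp Require Import zify.

Set Implicit Arguments.
Unset Strict Implicit.
Unset Printing Implicit Defensive.

(* A message m, encoded by an error-correcting code of constant rate and distance,
   is written into each of k ~ 1 / kappa successive phases: bit p of the codeword
   is the relative place of a decoy and of a reference item. A star is hidden in
   the first place (the slot) of phase f m, for a function f that agrees in at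
   most O(1/k) of the messages with any function computed by small circuits; such
   an f exists by counting. A second series of phases, without messages, may hold
   the star instead, a fair coin deciding.

   If the star is the maximum and the decoys beat the reference items, phase after
   phase, then the star looks like any decoy, and finding it amounts to computing
   f m. This bounds all small circuits.

   Without computational restriction, four algorithms share a constant success
   probability against every value order. Let the star be the maximum, call an
   item high if it beats the reference items that precede the phases, and call a
   column high if one of its decoys is. If a constant fraction of the columns is
   not high, then with constant probability no slot holds a high decoy, and the
   first high slot is the star. Otherwise the high decoys reveal enough bits to
   decode m, hence f m, before the second series starts. A maximum with two copies
   is found by the rule that stops at the first late item beating everything
   before it: with probability at least 1/4 the maximum is late and the second
   best item is not. *)

(** * Codes and hard functions *)

(** Sort [T] by [c] and number each element by its index. This later places positions in time by
    [stage] and items in value by [level]. *)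
Lemma monotone_numbering (T : finType) (n : nat) (c : T -> nat) : #|T| = n ->
  exists (u : T -> 'I_n) (v : 'I_n -> T),
    [/\ cancel u v, cancel v u & forall x y, c x < c y -> u x < u y].
Proof.
move=> cardT; pose r x y := c x <= c y; pose s := sort r (enum T).
have szs : size s = n by rewrite size_sort -cardE.
have ins x : x \in s by rewrite mem_sort mem_enum.
have us x : index x s < n by rewrite -szs index_mem.
have rtr : transitive r by move=> y x z; apply: leq_trans.
have srt : sorted r s by apply: sort_sorted => x y; apply: leq_total.
pose u x := Ordinal (us x).
have uI : injective u.
  by move=> x y /(congr1 val) /= /(congr1 (nth x s)); rewrite !nth_index.
have [v uK vK] : bijective u by apply: inj_card_bij => //; rewrite card_ord cardT.
exists u, v; split=> // x y cxy; rewrite ltnNge; apply/negP => /= leyx.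
have := sorted_leq_nth rtr (fun x => leqnn (c x)) x srt _ _ _ _ leyx.
rewrite !inE !szs !us !nth_index // /r => /(_ isT isT).
by rewrite leqNgt cxy.
Qed.

Definition hdist (T : finType) (x y : {ffun T -> bool}) : nat :=
  #|[set p | x p != y p]|.

Lemma hdistC (T : finType) (x y : {ffun T -> bool}) : hdist x y = hdist y x.
Proof. by apply: eq_card => p; rewrite !inE eq_sym. Qed.

(* Each y in the ball weighs at least 4 ^ (g - d) in the expansion of
   (1 + 4) ^ g over the coordinates where y agrees with x or not. *)
Lemma hamming_ball_card (g d : nat) (x : {ffun 'I_g -> bool}) :
  #|[set y | hdist x y < d]| * 4 ^ (g - d) <= 5 ^ g.
Proof.
have -> : 5 ^ g = \sum_(y : {ffun 'I_g -> bool}) 4 ^ (g - hdist x y).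
  transitivity (\prod_(p < g) \sum_(b : bool) (if x p != b then 1 else 4)).
    rewrite (eq_bigr (fun=> 5)) ?prod_nat_const ?card_ord // => p _.
    by rewrite big_bool; case: (x p).
  rewrite bigA_distr_bigA; apply: eq_bigr => y _ /=.
  rewrite (bigID (fun p => x p != y p)) /= big1 => [|p ->] //.
  rewrite mul1n (eq_bigr (fun=> 4)) => [|p /negbTE ->] //.
  rewrite prod_nat_const; congr (_ ^ _).
  have cC := cardsC [set p | x p != y p]; rewrite card_ord in cC.
  rewrite /hdist -[X in X - _]cC addKn; apply: eq_card => p.
  by rewrite !inE.
rewrite (bigID (mem [set y | hdist x y < d])) /= -sum_nat_const.
apply: leq_trans (leq_addr _ _); apply: leq_sum => y; rewrite inE => ltd.
by rewrite leq_pexp2l // leq_sub2l // ltnW.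
Qed.

(** A separated set of maximal size cannot be extended, so the balls of radius [d] around its
    elements cover all words; the bound on one ball then bounds the number of balls from below. *)
Lemma gilbert_varshamov (g d : nat) : 0 < d ->
  exists A : {set {ffun 'I_g -> bool}},
    {in A &, forall x y, x != y -> d <= hdist x y} /\
    2 ^ g * 4 ^ (g - d) <= #|A| * 5 ^ g.
Proof.
move=> d0; pose sep (A : {set {ffun 'I_g -> bool}}) :=
  [forall x in A, forall y in A, (x != y) ==> (d <= hdist x y)].
have sep0 : sep set0 by apply/forall_inP => x; rewrite inE.
case: (@arg_maxnP _ set0 sep (fun A => #|A|) sep0) => A sepA maxA.
have sepP : {in A &, forall x y, x != y -> d <= hdist x y}.
  move=> x y xA yA; move/forall_inP/(_ x xA)/forall_inP/(_ y yA): sepA.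
  exact: implyP.
exists A; split=> //.
have cov y : [exists x in A, hdist x y < d].
  apply: contraT => /exists_inPn noy.
  have yA : y \notin A.
    apply/negP => /noy; rewrite /hdist (_ : [set p | _] = set0) ?cards0 ?d0 //.
    by apply/setP => p; rewrite !inE eqxx.
  suff sepyA : sep (y |: A).
    by have := maxA _ sepyA; rewrite /= cardsU1 yA add1n ltnn.
  apply/forall_inP => u /setU1P uyA; apply/forall_inP => v /setU1P vyA.
  apply/implyP => neq; case: uyA vyA neq => [->|uA] [->|vA] neq.
  - by rewrite eqxx in neq.
  - by rewrite hdistC leqNgt noy.
  - by rewrite leqNgt noy.
  - exact: sepP.
have -> : 2 ^ g = #|{: {ffun 'I_g -> bool}}| by rewrite card_ffun card_bool card_ord.
apply: (@leq_trans (\sum_(x in A) #|[set y | hdist x y < d]| * 4 ^ (g - d))).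
  rewrite -big_distrl /= leq_mul2r -sum1_card; apply/orP; right.
  apply: (@leq_trans (\sum_(x in A) \sum_(y | hdist x y < d) 1)).
    rewrite (exchange_big_dep predT) //=; apply: leq_sum => y _.
    have /exists_inP[x xA xy] := cov y.
    by rewrite (bigD1 x) ?xA //= leq_addr.
  apply: leq_sum => x _; rewrite sum1_card subset_leq_card //.
  by apply/subsetP => y; rewrite !inE.
rewrite -sum_nat_const; apply: leq_sum => x _; exact: hamming_ball_card.
Qed.

(** Use [5 ^ 3 <= 2 ^ 7] for [5 * e] triples of factors and [5 <= 2 ^ 3] for the other [e] factors.
    The exponent 38 makes the code large enough: [2 ^ (16 * e) * 4 ^ (15 * e) = 2 ^ (46 * e)] leaves
    [2 ^ (8 * e)] codewords. *)
Lemma pow5_le_pow2 (e : nat) : 5 ^ (16 * e) <= 2 ^ (38 * e).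
Proof.
have -> : 16 * e = 3 * (5 * e) + e by lia.
have -> : 38 * e = 7 * (5 * e) + 3 * e by lia.
have mono a b d : a <= b -> a ^ d <= b ^ d by case: d => // d; rewrite leq_exp2r.
rewrite [5 ^ _]expnD [2 ^ _]expnD; apply: leq_mul.
  by rewrite [5 ^ _]expnM [2 ^ _]expnM; apply: mono.
by rewrite [2 ^ _]expnM; apply: mono.
Qed.

(* Coordinate 0 carries no information; it is reserved for the slot. *)
Lemma good_code (e N : nat) : 0 < e -> N <= 2 ^ (8 * e) ->
  exists enc : 'I_N -> 'I_(16 * e).+1 -> bool,
    (forall m, enc m ord0) /\
    (forall m m', m != m' -> e <= #|[set p | enc m p != enc m' p]|).
Proof.
move=> e0 leN; have [A [sepA cardA]] := @gilbert_varshamov (16 * e) e e0.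
have {cardA} cardA : N <= #|A|.
  apply: leq_trans leN _.
  have eq15 : 16 * e - e = 15 * e by lia.
  rewrite eq15 in cardA; rewrite -(@leq_pmul2r (5 ^ (16 * e))) ?expn_gt0 //.
  apply: leq_trans cardA; rewrite (_ : 4 = 2 ^ 2) // -expnM -expnD.
  apply: leq_trans (leq_mul (leqnn _) (pow5_le_pow2 e)) _.
  by rewrite -expnD leq_pexp2l //; lia.
pose cw m := enum_val (widen_ord cardA m).
have cwA m : cw m \in A by apply: enum_valP.
have cwI : injective cw.
  by move=> m m' /enum_val_inj /(congr1 val) /= /val_inj.
exists (fun m p => if unlift ord0 p is Some p' then cw m p' else true).
split=> [m | m m' neq]; first by rewrite unlift_none.
have /(sepA _ _ (cwA m) (cwA m')) : cw m != cw m' by rewrite (inj_eq cwI).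
move=> /leq_trans; apply.
rewrite /hdist -(card_imset (mem [set p | cw m p != cw m' p]) (@lift_inj _ ord0)).
apply: subset_leq_card.
by apply/subsetP => _ /imsetP[p pd ->]; rewrite inE in pd; rewrite inE !liftK.
Qed.

(** Bernoulli's inequality for [(1 - 1 / (k + 1)) ^ h], cleared of denominators. *)
Lemma bernoulli_nat (k h : nat) : h <= k.+1 -> k.+1 ^ h * (k.+1 - h) <= k.+1 * k ^ h.
Proof.
elim: h => [|h IH] hk; first by rewrite mul1n muln1 subn0.
have {}IH := IH (ltnW hk).
have : k.+1 ^ h * (k.+1 - h) * k <= k.+1 * k ^ h * k by rewrite leq_mul2r IH orbT.
rewrite -[X in _ <= X]mulnA -expnSr; apply: leq_trans.
rewrite expnSr -!mulnA leq_mul2l; apply/orP; right; nia.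
Qed.

(** Bernoulli with an exponent [h] of about half of [k] bounds [(1 + 1 / k) ^ h] by 2; squaring
    gives 4, and any excess of [h.*2] over the exponent is cancelled at the end. *)
Lemma succ_pow_le (k : nat) : k.+1 ^ k <= 4 * k ^ k.
Proof.
case: k => // k; set K := k.+1.
pose h := K.+1./2.
have h2 : h.*2 <= K.+1 by rewrite -[X in _ <= X]odd_double_half leq_addl.
have hK : K <= h.*2 by have := odd_double_half K.+1; rewrite -/h; case: odd; lia.
have half : K.+1 ^ h <= 2 * K ^ h.
  rewrite -(@leq_pmul2r K.+1) //.
  have := @bernoulli_nat K h ltac:(lia).
  have : K.+1 <= 2 * (K.+1 - h) by lia.
  move: (K.+1 ^ h) (K ^ h) => a b; nia.
have sq : K.+1 ^ h.*2 <= 4 * K ^ h.*2.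
  by rewrite -muln2 !expnM (_ : 4 = 2 ^ 2) // -expnMn leq_exp2r.
rewrite -(@leq_pmul2r (K.+1 ^ (h.*2 - K))) ?expn_gt0 // -expnD subnKC //.
apply: leq_trans sq _; rewrite -mulnA leq_mul2l /=.
rewrite -[X in K ^ X](subnKC hK) expnD leq_mul2l; apply/orP; right.
by case: (h.*2 - K) => // a; rewrite leq_exp2r.
Qed.

(* Exponential moment: the average over f of 2 ^ (number of agreements of f and
   h) is at most (1 + 1 / k) ^ (k M) <= 4 ^ M. *)
Lemma few_agreeing_functions (T : finType) (k M : nat) (h : T -> option 'I_k) :
    #|T| = (k * M)%N ->
  #|[set f : {ffun T -> 'I_k} | 3 * M < #|[set m | h m == Some (f m)]|]| * 2 ^ M
    <= k ^ (k * M).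
Proof.
move=> cardT; set B := [set f | _].
pose wt (o : option 'I_k) (j : 'I_k) := if o == Some j then 2 else 1.
have tot : \sum_(f : {ffun T -> 'I_k}) \prod_m wt (h m) (f m) <= 4 ^ M * k ^ (k * M).
  rewrite -(bigA_distr_bigA (fun m j => wt (h m) j)).
  apply: (@leq_trans (\prod_(m : T) k.+1)).
    apply: leq_prod => m _; case: (h m) => [j|]; last first.
      by rewrite sum_nat_const card_ord muln1.
    rewrite (bigD1 j) //= /wt eqxx (eq_bigr (fun=> 1)) => [|i neq].
      rewrite sum1_card; have := cardC1 j; rewrite card_ord => ->.
      by case: (k) j => [[]|] //.
    by rewrite (inj_eq Some_inj) eq_sym (negbTE neq).
  rewrite prod_nat_const cardT !expnM -expnMn.
  by case: (M) => // M'; rewrite leq_exp2r // succ_pow_le.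
have low : #|B| * 2 ^ (3 * M) <= 4 ^ M * k ^ (k * M).
  apply: leq_trans tot; rewrite (bigID (mem B)) /= -sum_nat_const.
  apply: leq_trans (leq_addr _ _); apply: leq_sum => f; rewrite inE => agr.
  apply: (@leq_trans (2 ^ #|[set m | h m == Some (f m)]|)).
    by rewrite leq_pexp2l // ltnW.
  rewrite -prod_nat_const.
  rewrite [X in _ <= X](bigID (mem [set m | h m == Some (f m)])) /=.
  rewrite [X in _ * X]big1 => [|m nm]; last first.
    by rewrite inE in nm; rewrite /wt (negbTE nm).
  rewrite muln1; apply: leq_prod => m; rewrite inE => eqm.
  by rewrite /wt eqm.
rewrite -(@leq_pmul2l (4 ^ M)) ?expn_gt0 //.
apply: leq_trans low; rewrite (_ : 4 = 2 ^ 2) // -expnM mulnCA -expnD.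
by rewrite leq_mul2l; apply/orP; right; rewrite leq_pexp2l //; lia.
Qed.

(** Union bound: each [h x] rules out at most a fraction [2 ^ - M] of all functions, so fewer than
    [2 ^ M] of them leave some [f] standing. *)
Lemma hard_function (T X : finType) (k M : nat) (h : X -> T -> option 'I_k) :
    0 < k -> #|T| = (k * M)%N -> #|X| < 2 ^ M ->
  exists f : T -> 'I_k, forall x, #|[set m | h x m == Some (f m)]| <= 3 * M.
Proof.
move=> k0 cardT cardX.
pose bad x := [set f : {ffun T -> 'I_k} | 3 * M < #|[set m | h x m == Some (f m)]|].
have [/existsP[f fP]|nof] := boolP [exists f, f \notin \bigcup_x bad x].
  exists f => x; rewrite leqNgt; apply: contra fP => agr.
  by apply/bigcupP; exists x => //; rewrite inE.
have full : k ^ (k * M) <= \sum_x #|bad x|.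
  rewrite -cardT -[k in k ^ _]card_ord -card_ffun.
  apply: (@leq_trans #|\bigcup_x bad x|).
    apply: subset_leq_card; apply/subsetP => f _.
    by move/existsPn/(_ f): nof; rewrite negbK.
  elim/big_rec2: _ => [|x a A _ leA]; first by rewrite cards0.
  by apply: leq_trans (leq_card_setU _ _) _; rewrite leq_add2l.
have : k ^ (k * M) * 2 ^ M <= #|X| * k ^ (k * M).
  apply: (@leq_trans ((\sum_x #|bad x|) * 2 ^ M)); first by rewrite leq_mul2r full orbT.
  rewrite big_distrl -sum_nat_const; apply: leq_sum => x _.
  exact: few_agreeing_functions.
by rewrite mulnC leq_mul2r leqNgt cardX orbF expn_eq0 -leqn0 leqNgt k0.
Qed.

(** * Comparison-based algorithms and circuits *)

Lemma mem_times_upto (n : nat) (t a : 'I_n) : (a \in times_upto t) = (a <= t).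
Proof. by rewrite mem_filter mem_enum andbT. Qed.

Lemma relative_order_eqP (n : nat) (pi sigma pi' sigma' : {perm 'I_n}) (t : 'I_n) :
  (forall a b : 'I_n, a <= t -> b <= t ->
     (rank_at pi sigma a < rank_at pi sigma b) =
     (rank_at pi' sigma' a < rank_at pi' sigma' b)) <->
  relative_order pi sigma t = relative_order pi' sigma' t.
Proof.
rewrite /relative_order; split=> [eqr | /eq_in_allpairs eqr a b at_ bt].
  by apply/eq_in_allpairs => a b; rewrite !mem_times_upto => at_ bt; apply: eqr.
by apply: eqr; rewrite mem_times_upto.
Qed.

Definition seen_comparisons (n : nat) (pi sigma : {perm 'I_n}) (t : 'I_n) :
    {set 'I_n * 'I_n} :=
  [set ab : 'I_n * 'I_n | [&& ab.1 <= t, ab.2 <= t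
     & rank_at pi sigma ab.1 < rank_at pi sigma ab.2]].

(** The bits are decoded by searching for any instance that produces them; all such instances have
    the same seen comparisons, so a rule may be stated on sets of comparisons. *)
Definition rule_algorithm (n : nat) (rule : 'I_n -> {set 'I_n * 'I_n} -> bool) :
    algorithm n :=
  fun t bits => [exists pi, exists sigma,
    (relative_order pi sigma t == bits) && rule t (seen_comparisons pi sigma t)].

Lemma rule_algorithmE (n : nat) (rule : 'I_n -> {set 'I_n * 'I_n} -> bool)
    (pi sigma : {perm 'I_n}) (t : 'I_n) :
  rule_algorithm rule t (relative_order pi sigma t) =
  rule t (seen_comparisons pi sigma t).
Proof.
apply/existsP/idP => [[pi' /existsP[sigma' /andP[/eqP/relative_order_eqP eqr]]]|ok].
  congr (rule t _); apply/setP => -[a b]; rewrite !inE /=.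
  by case: (leqP a t) => //= at_; case: (leqP b t) => //= bt; apply: eqr.
by exists pi; apply/existsP; exists sigma; rewrite eqxx.
Qed.

Lemma rule_selects_max (n : nat) (rule : 'I_n -> {set 'I_n * 'I_n} -> bool)
    (pi sigma : {perm 'I_n}) (x : 'I_n) :
    nat_of_ord ((sigma^-1)%g x) = 0 ->
    rule (pi x) (seen_comparisons pi sigma (pi x)) ->
    (forall u : 'I_n, u < pi x -> ~~ rule u (seen_comparisons pi sigma u)) ->
  selects_max (rule_algorithm rule) pi sigma.
Proof.
move=> x0 rx noru; apply/existsP; exists ((sigma^-1)%g x).
rewrite x0 eqxx permKV /selects /stops_at rule_algorithmE rx /=.
by apply/forallP => u; apply/implyP => ult; rewrite rule_algorithmE noru.
Qed.

Lemma eq_stops_at (n : nat) (A A' : algorithm n) (pi sigma pi' sigma' : {perm 'I_n})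
    (t : 'I_n) :
    (forall u : 'I_n, u <= t ->
       A u (relative_order pi sigma u) = A' u (relative_order pi' sigma' u)) ->
  stops_at A pi sigma t = stops_at A' pi' sigma' t.
Proof.
move=> eqA; rewrite /stops_at eqA //; congr (_ && _).
by apply: eq_forallb => u; case: ltnP => //= /ltnW ut; rewrite eqA.
Qed.

Lemma stops_at_inj (n : nat) (A : algorithm n) (pi sigma : {perm 'I_n}) (t u : 'I_n) :
  stops_at A pi sigma t -> stops_at A pi sigma u -> t = u.
Proof.
move=> /andP[At /forallP not_] /andP[Au /forallP nou]; apply/val_inj => /=.
case: (ltngtP t u) => // [tu|ut].
- by move: (implyP (nou t) tu); rewrite At.
- by move: (implyP (not_ u) ut); rewrite Au.
Qed.

(** A finite type large enough for all circuits with at most [S] gates and wires below [B], for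
    counting: a gate table, the number of gates used, and the output wire. *)
Definition circuit_code (S B : nat) : finType :=
  ({ffun 'I_S -> 'I_3 * 'I_B * 'I_B} * 'I_S.+1 * 'I_B)%type.

Definition gate_of_code (B : nat) (c : 'I_3 * 'I_B * 'I_B) : gate :=
  match nat_of_ord c.1.1 with
  | 0 => AndGate c.1.2 c.2
  | 1 => OrGate c.1.2 c.2
  | _ => NotGate c.1.2
  end.

Definition circuit_of_code (S B : nat) (c : circuit_code S B) : circuit :=
  Circuit (take c.1.2 [seq gate_of_code (c.1.1 i) | i <- enum 'I_S]) c.2.

Lemma gate_of_codeP (B m : nat) (g : gate) : gate_wf m g -> m <= B ->
  exists c : 'I_3 * 'I_B * 'I_B, gate_of_code c = g.
Proof.
move=> wf mB.
have lt i : i < m -> i < B by move=> /leq_trans; apply.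
case: g wf => [i j /andP[/lt iB /lt jB]|i j /andP[/lt iB /lt jB]|i /lt iB].
- by exists (inord 0, Ordinal iB, Ordinal jB); rewrite /gate_of_code /= inordK.
- by exists (inord 1, Ordinal iB, Ordinal jB); rewrite /gate_of_code /= inordK.
- by exists (inord 2, Ordinal iB, Ordinal iB); rewrite /gate_of_code /= inordK.
Qed.

Lemma gates_of_codes (B m : nat) (gs : seq gate) :
    gates_wf m gs -> m + size gs <= B ->
  exists cs, map (@gate_of_code B) cs = gs.
Proof.
elim: gs m => [|g gs IH] m /=; first by exists [::].
move=> /andP[wfg wfgs] szB.
have [c <-] := gate_of_codeP wfg (leq_trans (leq_addr _ _) szB).
have [cs <-] := IH _ wfgs ltac:(lia).
by exists (c :: cs).
Qed.

Lemma circuit_of_codeP (S B N : nat) (C : circuit) :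
    circuit_wf N C -> circuit_size C <= S -> N + S <= B ->
  exists c : circuit_code S B, circuit_of_code c = C.
Proof.
case: C => gs o /andP[/= wf oN] szS NSB; rewrite /circuit_size /= in szS.
have szB : N + size gs <= B by lia.
have [cs csE] := gates_of_codes wf szB.
have oB : o < B by lia.
have szcs : size cs = size gs by rewrite -csE size_map.
pose d := (ord0 : 'I_3, Ordinal oB, Ordinal oB).
exists ([ffun i : 'I_S => nth d cs i], inord (size gs), Ordinal oB).
rewrite /circuit_of_code /= inordK //; set L := map _ (enum _).
have szL : size L = S by rewrite size_map size_enum_ord.
congr Circuit; apply: (@eq_from_nth _ (NotGate 0)); first by rewrite size_takel ?szL.
move=> i; rewrite size_takel ?szL // => igs; have iS := leq_trans igs szS.
rewrite nth_take // (nth_map (Ordinal iS)) ?size_enum_ord // -csE.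
by rewrite (nth_map d) ?szcs // ffunE nth_enum_ord.
Qed.

Lemma card_circuit_code (S B : nat) :
  #|{: circuit_code S B}| = (3 * B * B) ^ S * S.+1 * B.
Proof. by rewrite !card_prod card_ffun !card_prod !card_ord. Qed.

(** * The arrival order *)

(* [Star] is the item that the hard instance makes maximal. Every name has two
   copies, of which a fair coin sends one to the front part of the arrival order
   and the other to its late part; at most one item, [Lead], is left over for
   parity. Reference names come in two halves, one for each value of a fair coin:
   the selected half arrives before all phases, the other one fills the phases.
   [Decoy i a] is the column-a name of phase i, and the [Tail] names form a second
   series of phases, with one name each. *)
Section Types.
Variables k g k2 q : nat.

Inductive name :=
  | Ref of bool & 'I_k & 'I_g.+1
  | Decoy of 'I_k & 'I_g.+1
  | Tail of 'I_k2.

Inductive item :=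
  | Star
  | Lead of 'I_q
  | Copy of name & bool.

Inductive pos :=
  | PLead of 'I_q
  | PRef of 'I_k & 'I_g.+1
  | PBlock of 'I_k & 'I_g.+1 & bool
  | PTail of 'I_k2
  | PTrash
  | PLate of name.

Definition name_sum (w : name) : bool * 'I_k * 'I_g.+1 + 'I_k * 'I_g.+1 + 'I_k2 :=
  match w with
  | Ref c i p => inl (inl (c, i, p))
  | Decoy i a => inl (inr (i, a))
  | Tail i => inr i
  end.

Definition sum_name (u : bool * 'I_k * 'I_g.+1 + 'I_k * 'I_g.+1 + 'I_k2) : name :=
  match u with
  | inl (inl (c, i, p)) => Ref c i p
  | inl (inr (i, a)) => Decoy i a
  | inr i => Tail i
  end.

Lemma name_sumK : cancel name_sum sum_name. Proof. by case. Qed.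
Lemma sum_nameK : cancel sum_name name_sum. Proof. by case=> [[[[? ?] ?]|[? ?]]|?]. Qed.

HB.instance Definition _ := Finite.copy name (can_type name_sumK).

Definition item_sum (x : item) : unit + 'I_q + name * bool :=
  match x with
  | Star => inl (inl tt)
  | Lead i => inl (inr i)
  | Copy w b => inr (w, b)
  end.

Definition sum_item (u : unit + 'I_q + name * bool) : item :=
  match u with
  | inl (inl _) => Star
  | inl (inr i) => Lead i
  | inr (w, b) => Copy w b
  end.

Lemma item_sumK : cancel item_sum sum_item. Proof. by case. Qed.
Lemma sum_itemK : cancel sum_item item_sum. Proof. by case=> [[[]|?]|[? ?]]. Qed.

HB.instance Definition _ := Finite.copy item (can_type item_sumK).

Definition pos_sum (p : pos) :
    'I_q + 'I_k * 'I_g.+1 + ('I_k * 'I_g.+1 * bool + 'I_k2) + (unit + name) :=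
  match p with
  | PLead i => inl (inl (inl i))
  | PRef i p => inl (inl (inr (i, p)))
  | PBlock i p b => inl (inr (inl (i, p, b)))
  | PTail i => inl (inr (inr i))
  | PTrash => inr (inl tt)
  | PLate w => inr (inr w)
  end.

Definition sum_pos
    (u : 'I_q + 'I_k * 'I_g.+1 + ('I_k * 'I_g.+1 * bool + 'I_k2) + (unit + name)) : pos :=
  match u with
  | inl (inl (inl i)) => PLead i
  | inl (inl (inr (i, p))) => PRef i p
  | inl (inr (inl (i, p, b))) => PBlock i p b
  | inl (inr (inr i)) => PTail i
  | inr (inl _) => PTrash
  | inr (inr w) => PLate w
  end.

Lemma pos_sumK : cancel pos_sum sum_pos. Proof. by case. Qed.
Lemma sum_posK : cancel sum_pos pos_sum.
Proof. by case=> [[[?|[? ?]]|[[[? ?] ?]|?]]|[[]|?]]. Qed.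

HB.instance Definition _ := Finite.copy pos (can_type pos_sumK).

Lemma card_name : #|{: name}| = 3 * k * g.+1 + k2.
Proof.
rewrite (bij_eq_card (Bijective name_sumK sum_nameK)).
rewrite !card_sum !card_prod card_bool !card_ord; lia.
Qed.

Lemma card_item : #|{: item}| = 1 + q + 6 * k * g.+1 + 2 * k2.
Proof.
rewrite (bij_eq_card (Bijective item_sumK sum_itemK)).
rewrite !card_sum card_prod card_name card_bool card_unit card_ord; lia.
Qed.

Lemma card_pos : #|{: pos}| = 1 + q + 6 * k * g.+1 + 2 * k2.
Proof.
rewrite (bij_eq_card (Bijective pos_sumK sum_posK)).
rewrite !card_sum !card_prod card_name card_bool card_unit !card_ord; lia.
Qed.

(** The value order of the hard instance: a higher level will mean a larger value, so later phases
    beat earlier ones and the star beats all. *)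
Definition level (x : item) : nat :=
  match x with
  | Star => (k + k2).+1
  | Copy (Tail i) _ => (k + i).+1
  | Copy (Decoy i _) _ => i.+1
  | _ => 0
  end.

(* Positions are arranged in time by increasing stage; within phase i, the slot
   [PBlock i ord0 true] comes first. *)
Definition stage (p : pos) : nat :=
  match p with
  | PLead _ => 0
  | PRef _ _ => 1
  | PBlock i p b => 2 + i.*2 + ~~ ((p == ord0) && b)
  | PTail i => 2 + k.*2 + i
  | PTrash => 2 + k.*2 + k2
  | PLate _ => 3 + k.*2 + k2
  end.

End Types.

Arguments Star {k g k2 q}.
Arguments PTrash {k g k2 q}.

Section Construction.
Variables (k g k2 q n : nat) (le_k_k2 : k <= k2).
Local Notation column := 'I_g.+1.
Local Notation nameT := (name k g k2).
Local Notation itemT := (item k g k2 q).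
Local Notation posT := (pos k g k2 q).

Variables (tm : posT -> 'I_n) (po : 'I_n -> posT).
Variables (num : itemT -> 'I_n) (itm : 'I_n -> itemT).
Hypothesis tmK : cancel tm po.
Hypotheses (numK : cancel num itm) (itmK : cancel itm num).
Hypothesis tm_stage : forall p p', stage p < stage p' -> tm p < tm p'.
Hypothesis num_level : forall x y, level y < level x -> num x < num y.

Variables (Msg : finType) (enc : Msg -> column -> bool) (f : Msg -> 'I_k).
Hypothesis enc0 : forall m, enc m ord0.

(* Column p of a phase has two consecutive places; bit p of the codeword of m
   tells which of them holds a decoy, the other one holding a reference item.
   The random rotation r of the columns makes the column in the slot uniform. *)
Definition front (m : Msg) (c : bool) (r : column) (w : nameT) : posT :=
  match w with
  | Ref c' i p => if c' == c then PRef _ _ i p else PBlock _ _ i p (~~ enc m p)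
  | Decoy i a => PBlock _ _ i (a + r)%R (enc m (a + r)%R)
  | Tail i => PTail _ _ _ i
  end.

Definition seat (m : Msg) (c : bool) (r : column) (s : {ffun nameT -> bool})
    (x : itemT) : posT :=
  match x with
  | Star => PTrash
  | Lead i => PLead _ _ _ i
  | Copy w b => if s w == b then front m c r w else PLate _ w
  end.

Lemma PBlock_inj i p b i' p' b' :
  PBlock k2 q i p b = PBlock k2 q i' p' b' :> posT -> [/\ i = i', p = p' & b = b'].
Proof. by case. Qed.

(** A decoy and a filling reference item in the same column take opposite places, and rotating the
    columns is injective. *)
Lemma front_inj m c r : injective (front m c r).
Proof.
case=> [c1 i1 p1|i1 a1|i1] [c2 i2 p2|i2 a2|i2] //=.
- have [->|n1] := eqVneq c1 c; have [->|n2] := eqVneq c2 c => //.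
    by case=> -> ->.
  by case=> -> ->; case: c1 c2 c n1 n2 => [] [] [].
- by case: ifP => // _ [_ ->]; case: enc.
- by case: ifP.
- by case: ifP => // _ [_ <-]; case: enc.
- by move/PBlock_inj => -[-> /GRing.addIr ->].
- by case: ifP.
- by case=> ->.
Qed.

Lemma seat_inj m c r s : injective (seat m c r s).
Proof.
have fr w : front m c r w = PTrash -> False by case: w => [c1 ? ?|? ?|?] //=; case: ifP.
have fl w i : front m c r w = PLead _ _ _ i -> False.
  by case: w => [c1 ? ?|? ?|?] //=; case: ifP.
have fla w w' : front m c r w = PLate _ w' -> False.
  by case: w => [c1 ? ?|? ?|?] //=; case: ifP.
case=> [|i1|w1 b1] [|i2|w2 b2] //=.
- by case: ifP => // _ /esym/fr.
- by case=> ->.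
- by case: ifP => // _ /esym/fl.
- by case: ifP => // _ /fr.
- by case: ifP => // _ /fl.
- case: ifP => s1; case: ifP => s2.
  + by move/front_inj => E; rewrite -E in s2 *; rewrite -(eqP s1) -(eqP s2).
  + by move/fla.
  + by move/esym/fla.
  + case=> E; rewrite -E in s2 *; congr Copy.
    by move: s1 s2; case: (s w1) b1 b2 => [] [] [].
Qed.

Lemma base_order_inj m c r s : injective (fun a => tm (seat m c r s (itm a))).
Proof. by move=> a b /(can_inj tmK) /seat_inj /(can_inj itmK). Qed.

Definition base_order m c r s : {perm 'I_n} := perm (@base_order_inj m c r s).

Lemma base_orderE m c r s x : base_order m c r s (num x) = tm (seat m c r s x).
Proof. by rewrite permE /= numK. Qed.

Definition target (b : bool) (j : 'I_k) : posT :=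
  if b then PTail _ _ _ (widen_ord le_k_k2 j) else PBlock _ _ j ord0 true.

(** The star, parked at the trash place, trades places with the occupant of the target. Only this
    swap involves [f]; the base order depends on [m] through its codeword alone. *)
Definition arrival m s b c r : {perm 'I_n} :=
  (base_order m c r s * tperm (tm PTrash) (tm (target b (f m))))%g.

Lemma target_lt_trash b j : tm (target b j) < tm PTrash.
Proof.
apply: tm_stage; case: b => /=; have := ltn_ord j; lia.
Qed.

Lemma target_inj b : injective (target b).
Proof.
by move=> i j; case: b => /= -[] // /val_inj.
Qed.

Lemma arrival_star m s b c r : arrival m s b c r (num Star) = tm (target b (f m)).
Proof. by rewrite permM base_orderE tpermL. Qed.

Lemma arrivalE m s b c r x :
    seat m c r s x != PTrash -> seat m c r s x != target b (f m) ->
  arrival m s b c r (num x) = tm (seat m c r s x).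
Proof.
move=> nT nt; rewrite permM base_orderE tpermD //; rewrite (can_eq tmK) eq_sym //.
Qed.

(* In the order of levels the occupant of a slot beats everything before it, so
   nothing seen up to that time tells whether it is the star. *)
Lemma slot_item m c r s b j : exists y,
  [/\ seat m c r s y = target b j, level y < level (Star : itemT)
    & forall x, tm (seat m c r s x) < tm (target b j) -> level x < level y].
Proof.
have stage_le p p' : tm p < tm p' -> stage p <= stage p'.
  by move=> lt; rewrite leqNgt; apply/negP => /tm_stage; rewrite ltnNge ltnW.
case: b => /=.
  exists (Copy _ (Tail _ _ (widen_ord le_k_k2 j)) (s (Tail _ _ (widen_ord le_k_k2 j)))).
  split=> [||x xlt] /=; [by rewrite eqxx | have := ltn_ord j; lia |].
  have := stage_le _ _ xlt.
  case: x xlt => [|i|[c' i p|i a|i] b] //=.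
  - by move=> _; have := ltn_ord j; lia.
  - by move=> _ _; have := ltn_ord i; lia.
  - case: ifP => _ /= xlt; last by have := ltn_ord j; lia.
    rewrite leq_add2l leq_eqVlt => /orP[/eqP ij|]; last by lia.
    move: xlt; rewrite (_ : i = widen_ord le_k_k2 j) ?ltnn //.
    exact: val_inj.
(* The rotation brings column [- r] to [ord0], whose bit is true by [enc0]: this decoy occupies the
   slot. *)
exists (Copy _ (Decoy _ j (- r)%R) (s (Decoy _ j (- r)%R))).
split=> [||x xlt] /=; [by rewrite eqxx GRing.addNr enc0 | have := ltn_ord j; lia |].
have := stage_le _ _ xlt.
case: x xlt => [|i|[c' i p|i a|i] b] //=.
- by move=> _; have := ltn_ord j; lia.
- case: ifP => _ /=; last by have := ltn_ord j; lia.
  case: eqP => [a0|_] /=; last by lia.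
  rewrite a0 enc0 /= => xlt ij.
  have : (i : nat) != j by apply/eqP => /val_inj E; move: xlt; rewrite E ltnn.
  lia.
- case: ifP => _ /=; have := ltn_ord j; lia.
Qed.

Lemma rank_at1 (pi : {perm 'I_n}) a : rank_at pi 1 a = (pi^-1)%g a.
Proof. by rewrite /rank_at invg1 perm1. Qed.

(** Strictly before the target time both orders show the same items, and at that time the star and
    the item [y] it displaces both beat everything earlier; so the swap is invisible. *)
Lemma relative_order_arrival m s b c r (u : 'I_n) : u <= tm (target b (f m)) ->
  relative_order (arrival m s b c r) 1 u = relative_order (base_order m c r s) 1 u.
Proof.
set T := tm (target b (f m)) => uT; apply/relative_order_eqP => a a' au a'u.
have [y [yT yS ylt]] := slot_item m c r s b (f m).
have TTr : T < tm PTrash by apply: target_lt_trash.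
have aV (t : 'I_n) : t < T ->
    ((arrival m s b c r)^-1)%g t = ((base_order m c r s)^-1)%g t.
  move=> tT; rewrite invMg permM tpermV tpermD //.
  - by apply: contraTneq (ltn_trans tT TTr) => <-; rewrite ltnn.
  - by apply: contraTneq tT => <-; rewrite ltnn.
have TV : ((arrival m s b c r)^-1)%g T = num Star.
  by apply: (canLR (permK _)); rewrite arrival_star.
have bV : ((base_order m c r s)^-1)%g T = num y.
  by apply: (canLR (permK _)); rewrite base_orderE yT.
have low (t : 'I_n) : t < T ->
    num y < ((base_order m c r s)^-1)%g t /\ num Star < ((base_order m c r s)^-1)%g t.
  move=> tT; set x := itm (((base_order m c r s)^-1)%g t).
  have xE : ((base_order m c r s)^-1)%g t = num x by rewrite itmK.
  have xy : level x < level y.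
    by apply: ylt; rewrite -base_orderE -xE permKV.
  by rewrite xE; split; apply: num_level => //; apply: ltn_trans yS.
have leT (t : 'I_n) : t <= T -> t < T \/ t = T.
  by rewrite leq_eqVlt => /orP[/eqP/val_inj|]; [right|left].
rewrite !rank_at1.
have [aT|->] := leT a (leq_trans au uT); have [a'T|->] := leT a' (leq_trans a'u uT).
- by rewrite !aV.
- have [l1 l2] := low _ aT.
  by rewrite TV bV aV // !ltnNge (ltnW l1) (ltnW l2).
- have [l1 l2] := low _ a'T.
  by rewrite TV bV aV // l1 l2.
- by rewrite !ltnn.
Qed.

(** The guess for [f m] that [A] makes when run without the swap. It is independent of [f], so [f]
    can be chosen afterwards to be hard for all such guesses. *)
Definition stop_phase (A : algorithm n) m s b c r : option 'I_k :=
  [pick j | stops_at A (base_order m c r s) 1 (tm (target b j))].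

Lemma eq_stop_phase (A A' : algorithm n) m s b c r :
    (forall t (pi sigma : {perm 'I_n}),
       A t (relative_order pi sigma t) = A' t (relative_order pi sigma t)) ->
  stop_phase A m s b c r = stop_phase A' m s b c r.
Proof.
by move=> eqA; apply: eq_pick => j; apply: eq_stops_at => u _; rewrite eqA.
Qed.

Lemma selects_max_stop_phase A m s b c r :
  selects_max A (arrival m s b c r) 1 -> stop_phase A m s b c r == Some (f m).
Proof.
case/existsP => z /andP[/eqP z0]; rewrite perm1 /selects.
have -> : z = num Star.
  apply/eqP; rewrite -(itmK z) (can_eq numK); apply/negPn/negP => nz.
  have /num_level : level (itm z) < level (Star : itemT).
    by case: (itm z) nz => [|i|[c' i p|i a|i] b'] //= _; have := ltn_ord i; lia.
  by rewrite itmK z0.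
rewrite arrival_star (@eq_stops_at _ A A _ _ (base_order m c r s) 1) => [st|u ule].
  rewrite /stop_phase; case: pickP => [j stj|/(_ (f m))]; last by rewrite st.
  by rewrite (target_inj (can_inj tmK (stops_at_inj stj st))).
by rewrite relative_order_arrival.
Qed.

(** * Four stopping rules against an arbitrary value order *)

Variable sigma : {perm 'I_n}.

Definition vrank (x : itemT) : nat := (sigma^-1)%g (num x).

Lemma vrank_inj : injective vrank.
Proof. by move=> x y /val_inj /perm_inj /(can_inj numK). Qed.

Lemma mem_seen (pi : {perm 'I_n}) (t : 'I_n) x y :
  ((pi (num x), pi (num y)) \in seen_comparisons pi sigma t) =
  [&& pi (num x) <= t, pi (num y) <= t & vrank x < vrank y].
Proof. by rewrite inE /= /rank_at !permK. Qed.

Definition lead_rule (t : 'I_n) (S : {set 'I_n * 'I_n}) : bool :=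
  [exists i, t == tm (PLead _ _ _ i)].

Definition late_rule (t : 'I_n) (S : {set 'I_n * 'I_n}) : bool :=
  [exists w, t == tm (PLate _ w)] && [forall u : 'I_n, (u < t) ==> ((t, u) \in S)].

Definition high_at (t : 'I_n) (S : {set 'I_n * 'I_n}) : bool :=
  [forall i, forall p, (t, tm (PRef _ _ i p)) \in S].

Definition slot_rule (t : 'I_n) (S : {set 'I_n * 'I_n}) : bool :=
  [exists i, (t == tm (PBlock _ _ i ord0 true)) && high_at t S].

(** If [m] is the message, the places opposite to its bits hold reference items, which are not high
    for a lucky coin [c]; a high item in such a place refutes [m]. *)
Definition consistent (m : Msg) (S : {set 'I_n * 'I_n}) : bool :=
  [forall i, forall p, ~~ high_at (tm (PBlock _ _ i p (~~ enc m p))) S].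

Definition decode_rule (t : 'I_n) (S : {set 'I_n * 'I_n}) : bool :=
  [exists m, (t == tm (target true (f m))) && consistent m S].

Lemma lead_wins m s b c r i : q <= 1 -> vrank (Lead _ _ _ i) = 0 ->
  selects_max (rule_algorithm lead_rule) (arrival m s b c r) sigma.
Proof.
move=> q1 vi; apply: (@rule_selects_max _ _ _ _ (num (Lead _ _ _ i))) => //.
  by apply/existsP; exists i; rewrite arrivalE //; case: (b).
move=> u; apply: contraL => /existsP[i' /eqP ->].
rewrite arrivalE //=; last by case: (b).
have -> : i' = i by apply: val_inj => /=; have := ltn_ord i; have := ltn_ord i'; lia.
by rewrite ltnn.
Qed.

Definition early (s : {ffun nameT -> bool}) (x : itemT) : bool :=
  if x is Copy w b then s w == b else true.

Lemma early_lt m s b c r x w : early s x -> arrival m s b c r (num x) < tm (PLate _ w).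
Proof.
move=> ex; rewrite permM base_orderE.
have TL b' j : tm (target b' j) < tm (PLate _ w).
  by apply: tm_stage; case: b' => /=; have := ltn_ord j; lia.
have TrL : tm PTrash < tm (PLate q w) by apply: tm_stage.
case: tpermP => // _ _; apply: tm_stage.
case: x ex => [|i|w' b'] //= ->.
by case: w' => [c' i p|i a|i] /=; have := ltn_ord i; [case: ifP => _ /=| |]; lia.
Qed.

(** The runner-up [y] arrives before every late place, so a late item that beats all its
    predecessors beats [y] and must be the maximum. *)
Lemma late_wins m (s : {ffun nameT -> bool}) b c r w b' y :
    vrank (Copy _ w b') = 0 -> s w != b' -> early s y ->
    (forall x, x != Copy _ w b' -> x != y -> vrank y < vrank x) ->
  selects_max (rule_algorithm late_rule) (arrival m s b c r) sigma.
Proof.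
move=> vw sw ey vy.
have lateE x w' b'' : x = Copy _ w' b'' -> s w' != b'' ->
    arrival m s b c r (num x) = tm (PLate _ w').
  by move=> -> /negbTE sw'; rewrite arrivalE /= sw' //; case: (b).
apply: (@rule_selects_max _ _ _ _ (num (Copy _ w b'))) => //.
  apply/andP; split; first by apply/existsP; exists w; rewrite (lateE _ w b').
  apply/forallP => u; apply/implyP => ut.
  set pi := arrival _ _ _ _ _ in ut *.
  have uE : u = pi (num (itm ((pi^-1)%g u))) by rewrite itmK permKV.
  rewrite uE mem_seen -uE leqnn (ltnW ut) vw lt0n /=.
  apply: contraTneq ut; rewrite -vw => /vrank_inj xE.
  by rewrite uE xE ltnn.
move=> u ult; apply/negP => /andP[/existsP[w' /eqP uw] /forallP beat].
set pi := arrival _ _ _ _ _ in ult beat.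
set x := itm ((pi^-1)%g u).
have uE : u = pi (num x) by rewrite itmK permKV.
have yu : pi (num y) < u by rewrite uw early_lt.
have := implyP (beat (pi (num y))) yu.
rewrite {1}uE mem_seen -uE leqnn (ltnW yu) /= ltnNge => /negP; apply.
apply/ltnW/vy.
  by apply: contraTneq ult => <-; rewrite uE ltnn.
by apply: contraTneq yu => <-; rewrite uE ltnn.
Qed.

Definition high (s : {ffun nameT -> bool}) (c : bool) (x : itemT) : bool :=
  [forall i, forall p, vrank x < vrank (Copy q (Ref k2 c i p) (s (Ref k2 c i p)))].

Definition high_columns (s : {ffun nameT -> bool}) (c : bool) : {set column} :=
  [set a | [exists i, high s c (Copy q (Decoy k2 i a) (s (Decoy k2 i a)))]].

Lemma high_atE m s b c r (t : 'I_n) x :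
    arrival m s b c r (num x) <= t -> (forall i p, tm (PRef _ _ i p) <= t) ->
  high_at (arrival m s b c r (num x)) (seen_comparisons (arrival m s b c r) sigma t) =
  high s c x.
Proof.
move=> xt rt; apply: eq_forallb => i; apply: eq_forallb => p.
have refE : arrival m s b c r (num (Copy q (Ref k2 c i p) (s (Ref k2 c i p)))) =
    tm (PRef _ _ i p).
  by rewrite arrivalE /= !eqxx //; case: (b).
have rt' := rt i p; rewrite -refE in rt'.
by rewrite -refE mem_seen xt rt'.
Qed.

Lemma slot_wins m s c r : vrank Star = 0 -> (- r)%R \notin high_columns s c ->
  selects_max (rule_algorithm slot_rule) (arrival m s false c r) sigma.
Proof.
move=> v0 nU; set pi := arrival _ _ _ _ _.
have ref_lt i p j : tm (PRef _ _ i p) <= tm (PBlock k2 q j ord0 true).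
  by apply/ltnW/tm_stage.
apply: (@rule_selects_max _ _ _ _ (num Star)) => //.
  apply/existsP; exists (f m); rewrite high_atE //; last first.
    by move=> i p; rewrite arrival_star; apply: ref_lt.
  rewrite /pi arrival_star eqxx; apply/forallP => i; apply/forallP => p.
  rewrite v0 lt0n; apply/eqP => vp.
  by have := vrank_inj (etrans vp (esym v0)).
move=> u; apply: contraL => /existsP[i /andP[/eqP uE]].
have [E|neq] := eqVneq i (f m); first by rewrite uE E arrival_star ltnn.
(* In every phase other than [f m] the slot still holds the decoy of column [- r], which is not high
   by assumption. *)
have slotE : pi (num (Copy q (Decoy k2 i (- r)%R) (s (Decoy k2 i (- r)%R)))) = u.
  have seatE : seat m c r s (Copy q (Decoy k2 i (- r)%R) (s (Decoy k2 i (- r)%R))) =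
      PBlock _ _ i ord0 true by rewrite /= eqxx GRing.addNr enc0.
  by rewrite arrivalE seatE ?uE //; apply: contraNneq neq => /PBlock_inj[->].
rewrite -[X in high_at X]slotE high_atE; first last.
- by move=> i' p; rewrite uE.
- by rewrite -/pi slotE.
by move=> hi; case/negP: nU; rewrite inE; apply/existsP; exists i.
Qed.

(* The only high places of the phases hold decoys, so each high column reveals
   its bit of the codeword. *)
Lemma decode_wins e m s c r :
    (forall m', m' != m -> e <= #|[set p | enc m' p != enc m p]|) ->
    vrank Star = 0 -> #|~: high_columns s c| < e ->
    (forall i p, ~~ high s c (Copy q (Ref k2 (~~ c) i p) (s (Ref k2 (~~ c) i p)))) ->
  selects_max (rule_algorithm decode_rule) (arrival m s true c r) sigma.
Proof.
move=> dist v0 smallU nohigh; set pi := arrival _ _ _ _ _.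
have ref_lt i p j : tm (PRef _ _ i p) <= tm (target true j).
  by apply/ltnW/tm_stage.
have blk_lt i p b j : tm (PBlock _ _ i p b) <= tm (target true j).
  by apply/ltnW/tm_stage => /=; have := ltn_ord i; case: (_ && _); lia.
apply: (@rule_selects_max _ _ _ _ (num Star)) => //.
  apply/existsP; exists m; rewrite /pi arrival_star eqxx.
  apply/forallP => i; apply/forallP => p.
  have blkE : pi (num (Copy q (Ref k2 (~~ c) i p) (s (Ref k2 (~~ c) i p)))) =
      tm (PBlock _ _ i p (~~ enc m p)).
    by rewrite arrivalE /= eqxx; case: (c).
  by rewrite -blkE high_atE ?nohigh // -/pi blkE.
move=> u; apply: contraL => /existsP[m' /andP[/eqP uE cons']].
have [E|neq] := eqVneq m' m; first by rewrite uE E arrival_star ltnn.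
have := dist m' neq; rewrite leqNgt => /negP[]; apply: leq_ltn_trans smallU.
(* If [m'] and [m] differ in bit [p], the decoys of column [p - r] stand where [m'] expects
   reference items, so consistency of [m'] makes that column not high. Fewer than [e] columns are
   so. *)
rewrite -(card_imset (mem [set p | enc m' p != enc m p]) (@GRing.addIr _ (- r)%R)).
apply: subset_leq_card.
apply/subsetP => a /imsetP[p]; rewrite [p \in _]inE => neqp ->{a}; rewrite !inE.
apply/existsPn => i.
have blkE : pi (num (Copy q (Decoy k2 i (p - r)%R) (s (Decoy k2 i (p - r)%R)))) =
    tm (PBlock _ _ i p (~~ enc m' p)).
  rewrite arrivalE /= eqxx GRing.subrK //.
  by move: neqp; case: (enc m p) (enc m' p) => [] [].
have := forallP (forallP cons' i) p.
rewrite -blkE high_atE // => [|i' p']; last by rewrite uE.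
by rewrite -/pi blkE uE.
Qed.

(** Otherwise each half would contain an item beating the whole other half, and these two items
    would beat each other. *)
Lemma exists_ref_top (s : {ffun nameT -> bool}) : exists c, forall i p,
  ~~ high s c (Copy q (Ref k2 (~~ c) i p) (s (Ref k2 (~~ c) i p))).
Proof.
pose bad := [exists i, exists p,
  high s true (Copy q (Ref k2 false i p) (s (Ref k2 false i p)))].
have [/existsP[i /existsP[p hi]]|nobad] := boolP bad; last first.
  by exists true => i p; move/existsPn/(_ i)/existsPn/(_ p): nobad.
exists false => i' p'; apply/negP => hi'.
have := forallP (forallP hi i') p'; have := forallP (forallP hi' i) p.
by move=> /ltn_trans lt /lt; rewrite ltnn.
Qed.

(** * Counting the winning outcomes *)

Definition outcome : finType :=
  (Msg * {ffun nameT -> bool} * (bool * bool * column))%type.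

Definition arrival_of (w : outcome) : {perm 'I_n} :=
  arrival w.1.1 w.1.2 w.2.1.1 w.2.1.2 w.2.2.

Definition wins (A : algorithm n) (tau : {perm 'I_n}) : nat :=
  #|[set w : outcome | selects_max A (arrival_of w) tau]|.

Lemma winsE A tau : wins A tau =
  \sum_(m : Msg) \sum_(s : {ffun nameT -> bool}) \sum_(t : bool * bool * column)
    selects_max A (arrival m s t.1.1 t.1.2 t.2) tau.
Proof.
rewrite !pair_bigA /= /wins -sum1dep_card big_mkcond /=.
by apply: eq_bigr => -[[m s] t] _; rewrite /arrival_of /=; case: selects_max.
Qed.

Lemma card_outcome : #|outcome| = #|Msg| * #|{ffun nameT -> bool}| * (4 * g.+1).
Proof. by rewrite !card_prod card_bool card_ord. Qed.

(** With the coins fixed, [stop_phase] is one function of the message, and a win requires it to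
    agree with [f] at [m]. *)
Lemma wins_upper A L :
    (forall s b c r, #|[set m | stop_phase A m s b c r == Some (f m)]| <= L) ->
  wins A 1 <= #|{ffun nameT -> bool}| * (4 * g.+1) * L.
Proof.
move=> bound; rewrite winsE exchange_big /= -mulnA -sum_nat_const.
apply: leq_sum => s _; rewrite exchange_big /=.
have -> : 4 * g.+1 = #|{: bool * bool * column}| by rewrite !card_prod card_bool card_ord.
rewrite -sum_nat_const; apply: leq_sum => -[[b c] r] _ /=.
apply: leq_trans (bound s b c r); rewrite -sum1_card [X in _ <= X]big_mkcond /=.
apply: leq_sum => m _; rewrite inE.
case: selects_max (@selects_max_stop_phase A m s b c r) => //.
by move=> ->.
Qed.

(** Fix [m], [s] and the lucky coin [c]. If fewer than [e] columns are not high, decoding wins for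
    every rotation when the star is in the tail; otherwise at least [e] rotations bring a column
    that is not high to the slot, and the slot rule wins when the star is in a phase. *)
Lemma wins_star e :
    (forall m m', m' != m -> e <= #|[set p | enc m' p != enc m p]|) ->
    e <= g.+1 -> vrank Star = 0 ->
  #|Msg| * #|{ffun nameT -> bool}| * e <=
  wins (rule_algorithm slot_rule) sigma + wins (rule_algorithm decode_rule) sigma.
Proof.
move=> dist eg v0; rewrite !winsE -big_split /= -mulnA -sum_nat_const.
apply: leq_sum => m _; rewrite -big_split /= -sum_nat_const; apply: leq_sum => s _.
have lower (b c : bool) (P : pred column) A :
    (forall r, P r -> selects_max A (arrival m s b c r) sigma) ->
  #|[set r | P r]| <= \sum_(t : bool * bool * column)
    selects_max A (arrival m s t.1.1 t.1.2 t.2) sigma.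
  move=> winP; have inj : injective (fun r : column => (b, c, r)) by move=> r r' [].
  rewrite -(card_imset (mem [set r | P r]) inj) -sum1_card big_mkcond /=.
  apply: leq_sum => t _; case: imsetP => // -[r]; rewrite inE => Pr ->.
  by rewrite winP.
have [c topc] := exists_ref_top s.
have [small|big] := ltnP #|~: high_columns s c| e.
  apply: leq_trans (leq_addl _ _).
  apply: leq_trans (lower true c predT _ _) => [|r _].
    by rewrite (_ : [set r | predT r] = [set: column]) ?cardsT ?card_ord.
  exact: decode_wins (dist m) v0 small topc.
apply: leq_trans (leq_addr _ _); apply: leq_trans big _.
apply: leq_trans (lower false c (fun r => (- r)%R \notin high_columns s c) _ _) => [|r nU].
  rewrite -(card_imset (mem (~: high_columns s c)) (@GRing.oppr_inj _)).
  apply: subset_leq_card; apply/subsetP => _ /imsetP[a ain ->].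
  by rewrite !inE in ain *; rewrite GRing.opprK.
exact: slot_wins.
Qed.

Lemma wins_lead i : q <= 1 -> vrank (Lead _ _ _ i) = 0 ->
  wins (rule_algorithm lead_rule) sigma = #|outcome|.
Proof.
move=> q1 vi; rewrite /wins -cardsT; apply: eq_card => w; rewrite !inE.
exact: lead_wins vi.
Qed.

(** At least a quarter of the coin assignments make the maximum late and the runner-up early: from
    any assignment one is reached by flipping at most the coins of their two names. *)
Lemma wins_late w b' : 1 < n -> vrank (Copy _ w b') = 0 ->
  #|outcome| <= 4 * wins (rule_algorithm late_rule) sigma.
Proof.
move=> n1 vw; pose y := itm (sigma (Ordinal n1)).
have vy : vrank y = 1 by rewrite /vrank itmK permK.
have vlt x : x != Copy _ w b' -> x != y -> vrank y < vrank x.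
  rewrite -(inj_eq vrank_inj) vw -(inj_eq vrank_inj) vy.
  by case: (vrank x) => [|[|]].
pose good (s : {ffun nameT -> bool}) := (s w != b') && early s y.
have card_good : #|{ffun nameT -> bool}| <= 4 * #|[set s | good s]|.
  pose flip (v : nameT) (s : {ffun nameT -> bool}) := [ffun u => s u (+) (u == v)].
  have flipE v s u : flip v s u = s u (+) (u == v) by rewrite ffunE.
  have flip_inj v : injective (flip v).
    move=> s s' /ffunP E; apply/ffunP => u.
    by have := E u; rewrite !flipE => /addIb.
  (* [Star] and [Lead] have no coin and are always early, so the default [w] is harmless. *)
  pose w' := if y is Copy v _ then v else w.
  have pre (h : {ffun nameT -> bool} -> {ffun nameT -> bool}) :
      injective h -> #|[set s | good (h s)]| <= #|[set s | good s]|.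
    move=> hI; rewrite -(card_imset (mem [set s | good (h s)]) hI).
    by apply: subset_leq_card; apply/subsetP => _ /imsetP[s sin ->]; rewrite !inE in sin *.
  have cover s : [|| good s, good (flip w s), good (flip w' s)
      | good (flip w (flip w' s))].
    have yw : y != Copy _ w b' by apply/eqP => E; move: vw; rewrite -E vy.
    rewrite /good /w'; case: (y) yw => [|i|v b] yw /=; rewrite ?flipE ?eqxx ?andbT.
    - by case: (s w) (b') => [] [].
    - by case: (s w) (b') => [] [].
    - have [E|neq] := eqVneq v w; rewrite ?E ?eqxx ?(negbTE neq) ?(eq_sym w v) ?(negbTE neq).
        have bb' : b != b' by apply: contraNneq yw => ->; rewrite E.
        by move: bb'; case: (s w) (b) (b') => [] [] [].
      by case: (s w) (s v) (b) (b') => [] [] [] [].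
  have -> : 4 * #|[set s | good s]| = #|[set s | good s]| + (#|[set s | good s]| +
      (#|[set s | good s]| + #|[set s | good s]|)) by lia.
  apply: leq_trans (_ : #|[set s | good s] :|: ([set s | good (flip w s)] :|:
      ([set s | good (flip w' s)] :|: [set s | good (flip w (flip w' s))]))| <= _).
    rewrite -cardsT; apply: subset_leq_card; apply/subsetP => s _; rewrite !inE.
    exact: cover.
  apply: leq_trans (leq_card_setU _ _) _; rewrite leq_add2l.
  apply: leq_trans (leq_card_setU _ _) _; apply: leq_add; first exact: pre.
  apply: leq_trans (leq_card_setU _ _) _; apply: leq_add; first exact: pre.
  by apply: (pre (fun s => flip w (flip w' s))) => s s' /flip_inj /flip_inj.
rewrite winsE card_outcome -mulnA big_distrr -sum_nat_const /=; apply: leq_sum => m _.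
rewrite exchange_big /= big_distrr /=.
have -> : 4 * g.+1 = #|{: bool * bool * column}| by rewrite !card_prod card_bool card_ord.
rewrite mulnC -sum_nat_const; apply: leq_sum => -[[b c] r] _ /=.
apply: leq_trans card_good _; rewrite leq_mul2l /= -sum1_card big_mkcond /=.
apply: leq_sum => s _; rewrite inE; case: ifP => // /andP[sw ey].
by rewrite (late_wins _ _ _ _ vw sw ey vlt).
Qed.

End Construction.

(** * Choice of parameters and the finite instance *)

Lemma circuit_families_lt (n e u v : nat) :
    1 < e -> n <= 2 ^ e -> u <= n -> v <= n ->
  ((3 * (n * n + 2 ^ e) * (n * n + 2 ^ e)) ^ (2 ^ e) * (2 ^ e).+1 * (n * n + 2 ^ e)) ^ n
    * (2 ^ u * (4 * v)) < 2 ^ (2 ^ (7 * e)).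
Proof.
move=> e1 ne un vn; set S := 2 ^ e; set B := n * n + S.
have eS : e <= S by rewrite ltnW // ltn_expl.
have S1 : 0 < S by rewrite expn_gt0.
have B2 : B <= 2 ^ (2 * e + 1).
  rewrite addn1 expnS mul2n -addnn; apply: leq_add.
    by rewrite mulnC expnM leq_mul.
  by rewrite leq_pexp2l //; lia.
have BB : 3 * B * B <= 2 ^ (4 * e + 4).
  have -> : 4 * e + 4 = 2 + (2 * e + 1) + (2 * e + 1) by lia.
  rewrite (expnD _ (2 + (2 * e + 1))) (expnD _ 2).
  by apply: leq_mul => //; apply: leq_mul.
have mono a b d : a <= b -> a ^ d <= b ^ d by case: d => // d; rewrite leq_exp2r.
have code : (3 * B * B) ^ S * S.+1 * B <= 2 ^ ((4 * e + 4) * S + (e + 1) + (2 * e + 1)).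
  rewrite (expnD _ (_ + (e + 1))) (expnD _ (_ * S)); apply: leq_mul => //.
  apply: leq_mul; first by rewrite expnM; apply: mono.
  by rewrite addn1 expnS mul2n -addnn -addn1 leq_add2l.
have vS : 4 * v <= 2 ^ (2 + e).
  by rewrite (expnD _ 2); apply: leq_mul => //; apply: leq_trans vn ne.
have tot : ((3 * B * B) ^ S * S.+1 * B) ^ n * (2 ^ u * (4 * v)) <=
    2 ^ (((4 * e + 4) * S + (e + 1) + (2 * e + 1)) * n + (u + (2 + e))).
  rewrite (expnD _ (_ * n)) expnM; apply: leq_mul; first exact: mono.
  by rewrite (expnD _ u); apply: leq_mul.
apply: leq_ltn_trans tot _; rewrite ltn_exp2l //.
(* The exponent is cubic in [S = 2 ^ e]; since [17 < 2 ^ 5] and [5 + 3 * e <= 7 * e] for [1 < e], it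
   stays below [2 ^ (7 * e)]. *)
apply: (@leq_ltn_trans (17 * (S * S * S))).
  have nS : n <= S := ne; have uS := leq_trans un ne; rewrite -/S in uS.
  have inner : (4 * e + 4) * S + (e + 1) + (2 * e + 1) <= 13 * (S * S) by nia.
  apply: leq_trans (leq_add (leq_mul inner nS) (leqnn _)) _.
  have : u + (2 + e) <= 4 * S by lia.
  nia.
apply: (@leq_trans (2 ^ 5 * (S * S * S))).
  by rewrite ltn_pmul2r // !muln_gt0 S1.
by rewrite /S -!expnD leq_pexp2l //; lia.
Qed.

Lemma finite_construction (n e k : nat) :
    1 < e -> 0 < k -> 1 + 6 * k * (16 * e).+1 + 2 * k <= n -> n <= 2 ^ e ->
  exists (T : finType) (PI : T -> {perm 'I_n}), [/\ 0 < #|T|,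
    exists A1 A2 A3 A4 : algorithm n, forall sigma,
      #|T| <= 68 * (#|[set w | selects_max A1 (PI w) sigma]| +
                    #|[set w | selects_max A2 (PI w) sigma]| +
                    #|[set w | selects_max A3 (PI w) sigma]| +
                    #|[set w | selects_max A4 (PI w) sigma]|)
  & forall A : algorithm n,
      (forall t : 'I_n, exists C : circuit,
         [/\ circuit_wf (t.+1 * t.+1) C, circuit_size C <= 2 ^ e
           & forall pi sigma : {perm 'I_n},
               circuit_eval C (relative_order pi sigma t) =
               A t (relative_order pi sigma t)]) ->
      k * #|[set w | selects_max A (PI w) 1%g]| <= 3 * #|T|].
Proof.
move=> e1 k0 nbig ne.
pose g := 16 * e; pose rest := n - (1 + 6 * k * g.+1).
(* What remains after the star and the copies of the phase names is filled by pairs of tail copies,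
   and by one [Lead] if it is odd. *)
pose k2 := rest %/ 2; pose q := rest %% 2.
have q1 : q <= 1 by have := ltn_pmod rest (isT : 0 < 2); rewrite /q; lia.
have rest2 : rest = k2 * 2 + q by apply: divn_eq.
have kk2 : k <= k2 by rewrite /k2 leq_divRL // /rest /g; lia.
have nE : 1 + q + 6 * k * g.+1 + 2 * k2 = n.
  have restE : rest + (1 + 6 * k * g.+1) = n by rewrite /rest /g; lia.
  by clearbody k2 q; lia.
have [tm [po [tmK poK tm_stage]]] :=
  monotone_numbering (@stage k g k2 q) (etrans (card_pos k g k2 q) nE).
(* Reversed, because rank 0 is the maximum. *)
pose colevel (x : item k g k2 q) := (k + k2).+1 - level x.
have level_max (x : item k g k2 q) : level x <= (k + k2).+1.
  by case: x => [|i|[c i p|i a|i] b] //=; have := ltn_ord i; lia.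
have [num [itm [numK itmK num_colevel]]] :=
  monotone_numbering colevel (etrans (card_item k g k2 q) nE).
have num_level x y : level y < level x -> num x < num y.
  move=> lt; apply: num_colevel; rewrite /colevel.
  by have := level_max x; have := level_max y; lia.
(* Large enough that [2 ^ M] exceeds the number of circuit families with coins, small enough that
   the [k * M] messages fit into the code. *)
pose M := 2 ^ (7 * e).
have NM : k * M <= 2 ^ (8 * e).
  have -> : 8 * e = e + 7 * e by lia.
  rewrite expnD leq_mul2r; apply/orP; right; apply: leq_trans ne; lia.
have [enc [enc0 dist]] := good_code (ltnW e1) NM.
pose code := circuit_code (2 ^ e) (n * n + 2 ^ e).
pose nameF := {ffun name k g k2 -> bool}.
(* Everything but the message that determines a stopping phase: one circuit per time, and all
   coins. *)
pose X : finType := ({ffun 'I_n -> code} * (nameF * (bool * bool * 'I_g.+1)))%type.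
pose alg (cc : {ffun 'I_n -> code}) : algorithm n :=
  fun t x => circuit_eval (circuit_of_code (cc t)) x.
pose h (x : X) (m : 'I_(k * M)) := stop_phase kk2 tmK itmK enc (alg x.1) m
  x.2.1 x.2.2.1.1 x.2.2.1.2 x.2.2.2.
have cardX : #|X| < 2 ^ M.
  rewrite !card_prod !card_ffun card_bool !card_ord card_circuit_code card_name.
  apply: circuit_families_lt => //; rewrite -nE; [lia | nia].
have [f fP] := hard_function h k0 (card_ord (k * M)) cardX.
exists (outcome k g k2 'I_(k * M)), (arrival_of kk2 tmK itmK enc f); split.
- by rewrite card_outcome card_ffun card_ord card_bool !muln_gt0 k0 !expn_gt0.
- exists (rule_algorithm (lead_rule tm)), (rule_algorithm (late_rule tm)),
    (rule_algorithm (slot_rule tm)), (rule_algorithm (decode_rule kk2 tm enc f)) => sigma.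
  have n1 : 1 < n by lia.
  pose x := itm (sigma (Ordinal (ltnW n1))).
  have vx : vrank num sigma x = 0 by rewrite /vrank itmK permK.
  pose W A := wins kk2 tmK itmK enc f A sigma.
  rewrite -[X in 68 * X]/(W _ + W _ + W _ + W _).
  case: x vx => [|i|w b] vx.
  + have dist' m m' : m' != m -> e <= #|[set p | enc m' p != enc m p]| by apply: dist.
    have eg : e <= g.+1 by rewrite /g; lia.
    have := wins_star kk2 tmK numK itmK tm_stage f enc0 dist' eg vx.
    rewrite -/(W _) -/(W _) card_outcome.
    rewrite /g; move: (#|_| * #|_|) => F Fe.
    have Fle : F <= F * e by rewrite leq_pmulr // ltnW.
    (* The constant 68 is [64 + 4], by [F <= F * e]. *)
    have -> : F * (4 * (16 * e).+1) = 64 * (F * e) + 4 * F by lia.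
    lia.
  + have := wins_lead kk2 tmK numK itmK enc f q1 vx; rewrite -/(W _) => <-; lia.
  + have := wins_late kk2 tmK numK itmK tm_stage enc f n1 vx; rewrite -/(W _).
    move/leq_trans; apply; lia.
- move=> A compA.
  have codeA t : exists c : code, forall pi sigma : {perm 'I_n},
      circuit_eval (circuit_of_code c) (relative_order pi sigma t) =
      A t (relative_order pi sigma t).
    have [C [wfC szC evC]] := compA t.
    have [|c cC] := @circuit_of_codeP (2 ^ e) (n * n + 2 ^ e) _ C wfC szC.
      by rewrite leq_add2r leq_mul.
    by exists c; rewrite cC.
  have [cc ccP] : exists cc : {ffun 'I_n -> code}, forall t (pi sigma : {perm 'I_n}),
      alg cc t (relative_order pi sigma t) = A t (relative_order pi sigma t).
    have [cc ccP] := fin_all_exists codeA.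
    by exists [ffun t => cc t] => t pi sigma; rewrite /alg ffunE ccP.
  have bound s b c r :
      #|[set m | stop_phase kk2 tmK itmK enc A m s b c r == Some (f m)]| <= 3 * M.
    apply: leq_trans (fP (cc, (s, (b, c, r)))); apply: subset_leq_card.
    by apply/subsetP => m; rewrite !inE /h /= (eq_stop_phase _ _ _ _ _ _ _ _ _ ccP).
  have := wins_upper numK tm_stage num_level enc0 bound.
  rewrite -/(wins kk2 tmK itmK enc f A 1%g) card_outcome card_ord.
  move: (wins _ _ _ _ _ _ _) #|{ffun _ -> _}| (4 * g.+1) => W F G; nia.
Qed.

(** Take the quotient of [n] by [105 * e]: the items needed number [96 * k * e + 8 * k + 1], at most
    [105 * k * e]. The factor 210 absorbs rounding down, as [k] is positive. *)
Lemma phases_fit (n e : nat) : 0 < e -> 105 * e <= n -> exists k,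
  [/\ 0 < k, 1 + 6 * k * (16 * e).+1 + 2 * k <= n & n <= 210 * (k * e)].
Proof.
move=> e0 en; exists (n %/ (105 * e)); set k := n %/ _.
have e0' : 0 < 105 * e by rewrite muln_gt0.
have k0 : 0 < k by rewrite divn_gt0.
have k_le : k * (105 * e) <= n := leq_trunc_div n (105 * e).
have k_gt : n < k.+1 * (105 * e) := ltn_ceil n e0'.
clearbody k; have ke : k <= k * e by rewrite leq_pmulr.
have ke' : e <= k * e by rewrite leq_pmull.
split=> //.
  apply: leq_trans k_le.
  have -> : 6 * k * (16 * e).+1 = 96 * (k * e) + 6 * k by lia.
  by rewrite mulnCA; lia.
apply: ltnW; apply: leq_trans k_gt _.
have -> : k.+1 * (105 * e) = 105 * (k * e) + 105 * e by lia.
lia.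
Qed.

(** * Winning probabilities *)

From mathcomp Require Import lra.
From mathcomp Require Import all_classical all_reals all_analysis.

Import Order.TTheory GRing.Theory Num.Theory.
Import numFieldNormedType.Exports.

Local Open Scope ring_scope.

Section Distributions.
Variables (R : realType) (n : nat).

Lemma dirac_ge0 (T : finType) (x0 x : T) : 0 <= (x == x0)%:R :> R.
Proof. exact: ler0n. Qed.

Lemma dirac_sum1 (T : finType) (x0 : T) : \sum_x (x == x0)%:R = 1 :> R.
Proof. by rewrite (bigD1 x0) //= eqxx big1 ?addr0 // => x /negbTE ->. Qed.

Definition dirac_distr (T : finType) (x0 : T) : distr R T :=
  Distr (dirac_ge0 x0) (dirac_sum1 x0).

Lemma win_prob_ge0 (D Q : distr R {perm 'I_n}) A : 0 <= win_prob D A Q.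
Proof.
apply: sumr_ge0 => pi _; apply: sumr_ge0 => sigma _.
by apply: mulr_ge0; apply: Defs.pmf_ge0.
Qed.

Lemma win_prob_le1 (D Q : distr R {perm 'I_n}) A : win_prob D A Q <= 1.
Proof.
rewrite -(Defs.pmf_sum1 D); apply: ler_sum => pi _.
rewrite -mulr_sumr -[X in _ <= X]mulr1; apply: ler_wpM2l; first exact: Defs.pmf_ge0.
rewrite -(Defs.pmf_sum1 Q) big_mkcond /=; apply: ler_sum => sigma _.
by case: ifP => // _; apply: Defs.pmf_ge0.
Qed.

Lemma val_alg_le (D Q : distr R {perm 'I_n}) A : val_alg D A <= win_prob D A Q.
Proof.
apply: ge_inf; last by exists Q.
by exists 0 => _ [Q' _ <-]; apply: win_prob_ge0.
Qed.

Lemma val_opt_ge (D : distr R {perm 'I_n}) (c : R) :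
    (forall Q : distr R {perm 'I_n}, exists A, c <= win_prob D A Q) ->
  c <= val_opt D.
Proof.
move=> good; apply: lb_le_inf; first by exists (sup (range (win_prob D ^~ D))), D.
move=> _ [Q _ <-]; have [A le_c] := good Q; apply: le_trans le_c _.
apply: ub_le_sup; last by exists A.
by exists 1 => _ [A' _ <-]; apply: win_prob_le1.
Qed.

Variables (T : finType) (PI : T -> {perm 'I_n}).
Hypothesis T_gt0 : (0 < #|T|)%N.

Definition push_pmf (pi : {perm 'I_n}) : R := \sum_(w | PI w == pi) #|T|%:R^-1.

Lemma push_pmf_ge0 pi : 0 <= push_pmf pi.
Proof. by apply: sumr_ge0 => w _; rewrite invr_ge0 ler0n. Qed.

Lemma push_pmf_sum1 : \sum_pi push_pmf pi = 1.
Proof.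
rewrite -(partition_big PI xpredT (P := xpredT)) //= sumr_const.
by rewrite -[X in X *+ _]mulr1 -mulrnAr mulVf // pnatr_eq0 -lt0n.
Qed.

Definition push_distr : distr R {perm 'I_n} := Distr push_pmf_ge0 push_pmf_sum1.

Lemma win_prob_push A (Q : distr R {perm 'I_n}) : win_prob push_distr A Q =
  \sum_sigma Q sigma * (#|[set w | selects_max A (PI w) sigma]|%:R / #|T|%:R).
Proof.
rewrite /win_prob (exchange_big_dep xpredT) //=; apply: eq_bigr => sigma _.
rewrite -mulr_suml mulrC; congr (_ * _).
rewrite -sum1dep_card natr_sum mulr_suml.
rewrite (partition_big PI (fun pi => selects_max A pi sigma)) //=.
apply: eq_bigr => pi sel; rewrite /push_pmf.
apply: eq_big => [w|w _]; last by rewrite mul1r.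
by case: eqP => [->|_]; rewrite ?sel ?andbF.
Qed.

(** Averaged over [Q], the four winning probabilities sum to at least [1 / N], so one of them is at
    least a quarter of that; which one may depend on [Q]. *)
Lemma val_opt_push (A1 A2 A3 A4 : algorithm n) (N : nat) : (0 < N)%N ->
    (forall sigma, #|T| <= N * (#|[set w | selects_max A1 (PI w) sigma]| +
                    #|[set w | selects_max A2 (PI w) sigma]| +
                    #|[set w | selects_max A3 (PI w) sigma]| +
                    #|[set w | selects_max A4 (PI w) sigma]|))%N ->
  (4 * N%:R)^-1 <= val_opt push_distr.
Proof.
move=> N0 good; apply: val_opt_ge => Q; set P := win_prob push_distr ^~ Q.
have N0' : 0 < N%:R :> R by rewrite ltr0n.
have T0' : 0 < #|T|%:R :> R by rewrite ltr0n.
have sumP : N%:R^-1 <= P A1 + P A2 + P A3 + P A4.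
  rewrite /P !win_prob_push -!big_split /=.
  have -> : N%:R^-1 = \sum_sigma Q sigma * N%:R^-1.
    by rewrite -mulr_suml Defs.pmf_sum1 mul1r.
  apply: ler_sum => sigma _.
  rewrite -!mulrDr; apply: ler_wpM2l; first exact: Defs.pmf_ge0.
  rewrite -!mulrDl ler_pdivlMr // mulrC ler_pdivrMr // -!natrD -natrM ler_nat mulnC.
  exact: good.
have -> : (4 * N%:R)^-1 = N%:R^-1 / 4 :> R by rewrite invfM mulrC.
have [le1|lt1] := lerP (N%:R^-1 / 4) (P A1); first by exists A1.
have [le2|lt2] := lerP (N%:R^-1 / 4) (P A2); first by exists A2.
have [le3|lt3] := lerP (N%:R^-1 / 4) (P A3); first by exists A3.
exists A4; rewrite -/(P A4); lra.
Qed.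

Lemma val_alg_push A sigma :
  val_alg push_distr A <= #|[set w | selects_max A (PI w) sigma]|%:R / #|T|%:R.
Proof.
apply: le_trans (val_alg_le _ (dirac_distr sigma) _) _.
rewrite win_prob_push (bigD1 sigma) //= eqxx mul1r big1 ?addr0 // => tau.
by move=> /negbTE ->; rewrite mul0r.
Qed.

End Distributions.

(** * Asymptotics *)

Lemma distribution_at (R : realType) (n : nat) (kap : R) :
    (1 < n)%N -> 0 < kap -> kap < 1 / 100 -> 4 / ln 2 <= n%:R * kap / ln n%:R ->
  exists D : distr R {perm 'I_n}, 1 / 272 <= val_opt D /\
    forall A : algorithm n, computable_by_size A (2 `^ (n%:R * kap / 4)) ->
      val_alg D A <= 315 * kap.
Proof.
move=> n1 kap0 kap1 large.
have n0' : 0 < n%:R :> R by rewrite ltr0n; lia.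
have ln2 : 0 < ln 2 :> R by rewrite ln_gt0 // ltr1n.
have ln2n : ln 2 <= ln n%:R :> R by rewrite ler_ln ?posrE ?ler_nat.
have lnn : 0 < ln n%:R :> R by apply: lt_le_trans ln2n.
have le_ln : 4 * ln n%:R <= n%:R * kap * ln 2.
  by move: large; rewrite ler_pdivlMr // mulrAC ler_pdivrMr.
have nk4 : 4 <= n%:R * kap by rewrite -(ler_pM2r ln2); lra.
(* Rounding up makes [2 ^ e] bound both the circuit size and, by [le_ln], [n] itself; by [nk4] the
   rounding costs at most a factor 2 in [e]. *)
pose e := (Num.trunc (n%:R * kap / 4)).+1.
have /andP[tr_le lt_tr] := @truncn_itv R (n%:R * kap / 4) ltac:(lra).
have e1 : (1 < e)%N by rewrite ltnS ltnNge truncn_le_nat -leNgt; lra.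
have eE : e%:R = (Num.trunc (n%:R * kap / 4))%:R + 1 :> R by rewrite natr1.
have e_ge : n%:R * kap / 4 <= e%:R by apply: ltW.
have e_le : e%:R <= n%:R * kap / 2 by lra.
have ne : (n <= 2 ^ e)%N.
  rewrite -(ler_nat R) natrX -ler_ln ?posrE ?exprn_gt0 // lnXn // -[X in _ <= X]mulr_natl.
  have : n%:R * kap / 4 * ln 2 <= e%:R * ln 2 by rewrite ler_pM2r.
  by lra.
clearbody e; have nk_le : n%:R * kap <= n%:R / 100 by rewrite ler_pM2l //; lra.
have en : (105 * e <= n)%N by rewrite -(ler_nat R) natrM; lra.
have [k [k0 nbig k_ge]] := phases_fit (ltnW e1) en.
have {}k_ge : n%:R <= 210 * (k%:R * e%:R) :> R by rewrite -natrM -natrM ler_nat.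
have [T [PI [T0 [A1 [A2 [A3 [A4 good]]]] hard]]] := finite_construction e1 k0 nbig ne.
exists (push_distr R PI T0); split.
  have := val_opt_push R T0 (isT : (0 < 68)%N) good.
  by rewrite (_ : (4 * 68%:R)^-1 = 1 / 272) // div1r -natrM.
move=> A compA; have le_val := @val_alg_push R n T PI T0 A 1%g.
apply: (le_trans le_val) => {le_val}.
have := hard A _; set W := #|_| => kW.
have {}kW : (k * W <= 3 * #|T|)%N.
  apply: kW => t; have [C [wf sz ev]] := compA t; exists C; split=> //.
  rewrite -(ler_nat R) natrX; apply: le_trans sz _.
  by rewrite -powR_mulrn // ler_powR // ler1n.
have k0' : 0 < k%:R :> R by rewrite ltr0n.
rewrite ler_pdivrMr ?ltr0n // -(ler_pM2l k0') -natrM.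
apply: (@le_trans _ _ (3 * #|T|)%:R); first by rewrite ler_nat.
rewrite natrM mulrA; apply: ler_wpM2r; first exact: ler0n.
(* From [n <= 210 * k * e] and [e <= n * kap / 2] follows [1 <= 105 * k * kap], hence
   [3 <= 315 * k * kap]. *)
have : k%:R * e%:R <= k%:R * (n%:R * kap / 2) by rewrite ler_pM2l.
have : n%:R * 1 <= n%:R * (105 * (k%:R * kap)) -> 1 <= 105 * (k%:R * kap).
  by rewrite ler_pM2l.
move=> cancel_n ke_le; suff /cancel_n : n%:R * 1 <= n%:R * (105 * (k%:R * kap)) by lra.
by lra.
Qed.

Local Open Scope classical_set_scope.
Local Open Scope ring_scope.

Theorem mainTheorem14 (R : realType) (kappa : nat -> R)
  (kappa_gt0 : forall n : nat, 0 < kappa n)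
  (kappa_cvg0 : kappa n @[n --> \oo] --> (0 : R))
  (kappa_large : n%:R * kappa n / ln (n%:R : R) @[n --> \oo] --> +oo%R) :
  exists D : forall n : nat, distr R {perm 'I_n},
    (exists c : R, 0 < c /\ \forall n \near \oo, c <= val_opt (D n)) /\
    (exists C : R, \forall n \near \oo, forall A : algorithm n,
       computable_by_size A (2 `^ (n%:R * kappa n / 4)) ->
       val_alg (D n) A <= C * kappa n).
Proof.
pose good n := [/\ (1 < n)%N, kappa n < 1 / 100
  & 4 / ln 2 <= n%:R * kappa n / ln (n%:R : R)].
have ex n : {D : distr R {perm 'I_n} | good n -> 1 / 272 <= val_opt D /\
    forall A : algorithm n, computable_by_size A (2 `^ (n%:R * kappa n / 4)) ->
      val_alg D A <= 315 * kappa n}.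
  apply: cid; have [[n1 small large]|bad] := pselect (good n).
    by have [D DP] := distribution_at n1 (kappa_gt0 n) small large; exists D.
  (* An arbitrary distribution for the finitely many [n] that are not good. *)
  by exists (dirac_distr R 1%g).
have near_good : \forall n \near \oo, good n.
  near=> n; split.
  - by near: n; apply: nbhs_infty_gt.
  - by near: n; apply: (cvgr_lt _ kappa_cvg0); lra.
  - by near: n; move/cvgryPge: kappa_large; apply.
exists (fun n => sval (ex n)); split.
  exists (1 / 272); split; first by lra.
  by apply: filterS near_good => n gn; have [] := svalP (ex n) gn.
exists 315; apply: filterS near_good => n gn.
by have [] := svalP (ex n) gn.
Unshelve. all: by end_near.
Qed.
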